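(* Let $\mathcal G_0$ and $\mathcal G_1$ be connected simple graphs on disjoint vertex sets $V_0$ and $V_1$ with $V_0\cup V_1=n=\{0,1,\ldots,n-1\}$ and $\min\{|V_0|,|V_1|\}\ge 2$. Let $C$ be a nonempty set of edges each having one endpoint in $V_0$ and the other in $V_1$, and let $\mathcal G=\langle n;E\rangle$ be the graph whose edge set $E$ is the union of the edge sets of $\mathcal G_0$, $\mathcal G_1$ and $C$. If $|C|<\min\{|V_0|,|V_1|\}$, then $\mathcal G$ is not perm-complete.
   Context: Permutations in $\mathrm{Sym}(n)$ compose left to right. For a finite sequence $\mathbf s$ in $\mathrm{Sym}(n)$, $\bigcirc\mathbf s$ is the composite of its terms in order, $\mathrm{Seq}(\mathbf s)$ the set of its rearrangements and $\mathrm{Prod}(\mathbf s)=\{\bigcirc\mathbf r:\mathbf r\in\mathrm{Seq}(\mathbf s)\}$; $\mathbf s$ is perm-complete iff $\mathrm{Prod}(\mathbf s)$ is $\mathrm{Alt}(n)$ or $\mathrm{Sym}(n)\setminus\mathrm{Alt}(n)$. A simple graph on vertex set $n$ is perm-complete iff the sequence listing each of its edges $(x\,y)$ exactly once as the transposition $(x\,y)\in\mathrm{Sym}(n)$ is perm-complete (the order of listing is irrelevant). *)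

(* Defs.v *)
From mathcomp Require Import all_boot all_fingroup all_solvable.

Set Implicit Arguments.
Unset Strict Implicit.
Unset Printing Implicit Defensive.

Local Open Scope group_scope.

(* MathComp's product in 'S_n composes left to right: (s * t) x = t (s x). *)
Definition bigcomp (n : nat) (s : seq 'S_n) : 'S_n := \prod_(t <- s) t.

Definition Prod (n : nat) (s : seq 'S_n) : {set 'S_n} :=
  [set p in [seq bigcomp r | r <- permutations s]].

Definition perm_complete (n : nat) (s : seq 'S_n) : Prop :=
  Prod s = 'Alt_('I_n) \/ Prod s = 'Sym_('I_n) :\: 'Alt_('I_n).

(* A graph is given by its vertex set V and its set E of edges, an edge being
   the two-element set of its endpoints. *)
Definition simple_graph (n : nat) (V : {set 'I_n}) (E : {set {set 'I_n}}) :
    Prop :=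
  forall e, e \in E -> #|e| = 2 /\ e \subset V.

Definition adj (n : nat) (E : {set {set 'I_n}}) : rel 'I_n :=
  [rel x y | [set x; y] \in E].

(* When E is the edge set of a simple graph on V, walks starting in V stay in
   V, so connect may range over the whole of 'I_n. *)
Definition connected_graph (n : nat) (V : {set 'I_n}) (E : {set {set 'I_n}}) :
    Prop :=
  V != set0 /\ {in V &, forall x y, connect (adj E) x y}.

(* The condition p.1 < p.2 makes each edge occur exactly once. *)
Definition edge_transpositions (n : nat) (E : {set {set 'I_n}}) : seq 'S_n :=
  [seq tperm p.1 p.2 | p in [pred p : 'I_n * 'I_n | p.1 < p.2 & adj E p.1 p.2]].

Definition perm_complete_graph (n : nat) (E : {set {set 'I_n}}) : Prop :=
  perm_complete (edge_transpositions E).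

(* Main.v *)
Require Import Defs.
From mathcomp Require Import all_boot all_fingroup all_solvable.

Set Implicit Arguments.
Unset Strict Implicit.
Unset Printing Implicit Defensive.

(** The number of points that a permutation carries from [V0] into [V1] is
    subadditive under composition, and a transposition along an edge
    contributes at most [1], and [0] unless the edge belongs to [C].  Hence
    every product of the edges carries at most [#|C|] points from [V0] into
    [V1].  As [#|C| < minn #|V0| #|V1|], some permutation carries more, and
    composing it with a transposition inside [V1] yields one of each parity. *)

Section Crossing.

Local Open Scope group_scope.

Variable T : finType.
Implicit Types (A B : {set T}) (p q : {perm T}).

Definition crossing A B p : nat := #|[set x in A | p x \in B]|.

Lemma crossing1 A B : [disjoint A & B] -> crossing A B 1 = 0.
Proof.
move=> dAB; apply: eq_card0 => x; rewrite inE perm1.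
by apply/andP=> -[xA xB]; rewrite (disjointFr dAB xA) in xB.
Qed.

(** If [p * q] carries [x] from [A] into [B], then either [p x] is already in [B], or [p x] is in
    [A] and [q] carries it into [B]. The points of the second kind are counted through their images
    under [p]. *)
Lemma crossingM A B p q : A :|: B = [set: T] ->
  crossing A B (p * q) <= crossing A B p + crossing A B q.
Proof.
move=> covAB; rewrite /crossing.
rewrite -(card_imset [set x in A | q x \in B] (@perm_inj _ p^-1)).
apply: leq_trans (leq_card_setU _ _); apply/subset_leq_card/subsetP=> x.
rewrite !inE permM => /andP[xA qpxB]; rewrite xA /=.
case: (boolP (p x \in B)) => //= pxNB; apply/imsetP; exists (p x).
  rewrite inE qpxB andbT.
  by have := in_setT (p x); rewrite -covAB inE (negPf pxNB) orbF.
by rewrite permK.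
Qed.

Lemma crossing_prod A B (r : seq {perm T}) :
  [disjoint A & B] -> A :|: B = [set: T] ->
  crossing A B (\prod_(t <- r) t) <= \sum_(t <- r) crossing A B t.
Proof.
move=> dAB covAB; elim: r => [|t r IHr]; first by rewrite !big_nil crossing1.
by rewrite !big_cons (leq_trans (crossingM _ _ covAB)) ?leq_add2l.
Qed.

(** A point that crosses is moved, hence is [a] or [b]; if both crossed, each would lie in [A] and
    in [B]. *)
Lemma crossing_tperm_le1 A B a b :
  [disjoint A & B] -> crossing A B (tperm a b) <= 1.
Proof.
move=> dAB; apply/card_le1_eqP=> x y; rewrite !inE.
case: tpermP => [->|->|_ _] /andP[xA xB]; 
  last by rewrite (disjointFr dAB xA) in xB.
all: case: tpermP => [->|->|_ _] /andP[yA yB] //.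
all: by rewrite ?(disjointFr dAB xA) ?(disjointFr dAB yA) in xB yB.
Qed.

Lemma crossing_tperm_eq0 A B a b :
  [disjoint A & B] -> (a \in A) = (b \in A) -> (a \in B) = (b \in B) ->
  crossing A B (tperm a b) = 0.
Proof.
move=> dAB abA abB; apply: eq_card0 => x; rewrite inE.
apply/andP=> -[xA]; suff -> : (tperm a b x \in B) = (x \in B).
  by rewrite (disjointFr dAB xA).
by case: tpermP => [->|->|].
Qed.

Lemma crossing_mul_tperm A B p a b :
  a \in B -> b \in B -> crossing A B (p * tperm a b) = crossing A B p.
Proof.
move=> aB bB; apply: eq_card => x; rewrite !inE permM.
by case: tpermP => [->|->|] //; rewrite ?aB ?bB.
Qed.

(** Writing [A] before [B] above [B] before [A] gives a permutation in two-line notation; its first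
    [minn #|A| #|B|] columns have the top entry in [A] and the bottom entry in [B]. *)
Lemma exists_crossing A B :
  [disjoint A & B] -> A :|: B = [set: T] ->
  exists p, minn #|A| #|B| <= crossing A B p.
Proof.
move=> dAB covAB.
set s := enum A ++ enum B; set t := enum B ++ enum A.
have size_st : size s = size t by rewrite !size_cat addnC.
have uniq_s : uniq s.
  rewrite cat_uniq !enum_uniq /= andbT -all_predC; apply/allP=> x /=.
  by rewrite !mem_enum => xB; rewrite (disjointFl dAB).
have uniq_t : uniq t by rewrite /t uniq_catC.
have s_all x : x \in s by rewrite mem_cat !mem_enum -in_setU covAB inE.
have lt_t x : index x s < size t by rewrite -size_st index_mem.
pose g x := nth x t (index x s).
have g_inj : injective g.
  (* [g] uses its own argument as the default of [nth], so the two defaults must agree before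
     uniqueness of [t] applies. *)
  move=> x y; rewrite /g (set_nth_default x y) // => /eqP.
  rewrite nth_uniq // => /eqP eq_xy.
  by rewrite -(nth_index x (s_all x)) eq_xy nth_index.
exists (perm g_inj); set m := minn _ _.
have sz_m : size (take m (enum A)) = m.
  by rewrite size_takel // -cardE geq_minl.
rewrite -[leqLHS]sz_m -(card_uniqP (take_uniq m (enum_uniq A))).
apply/subset_leq_card/subsetP=> x xm; rewrite inE permE.
have xA : x \in enum A by apply: mem_take xm.
rewrite -mem_enum xA /= /g index_cat xA nth_cat -cardE.
have ltm : index x (enum A) < m by rewrite index_ltn.
have ltB : index x (enum A) < #|B| by rewrite (leq_trans ltm) ?geq_minr.
by rewrite ltB -mem_enum mem_nth // -cardE.
Qed.

End Crossing.

Lemma Prod_crossing_le (n : nat) (A B : {set 'I_n}) (s : seq 'S_n) (p : 'S_n) :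
  [disjoint A & B] -> A :|: B = [set: 'I_n] -> p \in Prod s ->
  crossing A B p <= \sum_(t <- s) crossing A B t.
Proof.
move=> dAB covAB; rewrite inE => /mapP[r]; rewrite mem_permutations => rs ->.
by rewrite -(perm_big _ rs); apply: crossing_prod.
Qed.

Lemma perm_complete_odd_or_even (n : nat) (s : seq 'S_n) (p q : 'S_n) :
  perm_complete s -> odd_perm p != odd_perm q -> p \in Prod s \/ q \in Prod s.
Proof.
move=> [] -> pq; rewrite ?in_setD !Alt_even ?inE;
  by case: odd_perm pq; case: odd_perm => //; auto.
Qed.

(** The smaller element of the set must be the first component. *)
Lemma set2_ltn_inj (n : nat) :
  {in [pred p : 'I_n * 'I_n | p.1 < p.2] &,
    injective (fun p => [set p.1; p.2])}.
Proof.
move=> [a b] [c d]; rewrite !inE /= => ab cd eq_e.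
have := set22 a b; have := set21 a b; rewrite eq_e.
case/set2P=> ac /set2P[] bd; move: ab; rewrite ac bd ?ltnn //.
by move=> /(ltn_trans cd); rewrite ltnn.
Qed.

Lemma sum_crossing_edges_le (n : nat) (A B : {set 'I_n})
    (E C : {set {set 'I_n}}) :
  [disjoint A & B] ->
  (forall e, e \in E -> e \notin C -> e \subset A \/ e \subset B) ->
  \sum_(t <- edge_transpositions E) crossing A B t <= #|C|.
Proof.
move=> dAB inner; rewrite /edge_transpositions big_map big_enum /=.
(* The edges in [C] as increasing pairs: the sum is compared termwise with the indicator of [P]. *)
pose P := [pred p : 'I_n * 'I_n | p.1 < p.2 & [set p.1; p.2] \in C].
have leP : #|P| <= #|C|.
  have injP : {in P &, injective (fun p : 'I_n * 'I_n => [set p.1; p.2])}.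
    by move=> p q /andP[lp _] /andP[lq _]; apply: set2_ltn_inj.
  rewrite -(card_in_imset injP); apply/subset_leq_card/subsetP=> e.
  by case/imsetP=> p /andP[_ pC] ->.
apply: leq_trans leP; rewrite -sum1_card big_mkcond [leqRHS]big_mkcond /=.
apply: leq_sum => -[a b] _; rewrite !inE /=.
case: ltnP => //= _; case: (boolP (adj E a b)) => // abE.
case: (boolP ([set a; b] \in C)) => [_|abC]; first exact: crossing_tperm_le1.
rewrite crossing_tperm_eq0 //;
  by case: (inner _ abE abC) => /subsetP sub;
  have := sub a (set21 a b); have := sub b (set22 a b) => bX aX;
  rewrite ?bX ?aX ?(disjointFr dAB aX) ?(disjointFr dAB bX)
          ?(disjointFl dAB aX) ?(disjointFl dAB bX).
Qed.

Theorem theorem2p7 (n : nat) (V0 V1 : {set 'I_n})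
    (E0 E1 C : {set {set 'I_n}})
    (simple0 : simple_graph V0 E0) (simple1 : simple_graph V1 E1)
    (conn0 : connected_graph V0 E0) (conn1 : connected_graph V1 E1)
    (disjV : [disjoint V0 & V1]) (coverV : V0 :|: V1 = [set: 'I_n])
    (minV : 2 <= minn #|V0| #|V1|)
    (C_neq0 : C != set0)
    (C_cross : forall e, e \in C ->
       exists x y, [/\ x \in V0, y \in V1 & e = [set x; y]])
    (C_small : #|C| < minn #|V0| #|V1|) :
  ~ perm_complete_graph (E0 :|: E1 :|: C).
Proof.
move=> complete.
have [p lt_p] := exists_crossing disjV coverV.
have /card_gt1P[a [b [aV bV ab]]] : 1 < #|V1|.
  exact: leq_trans minV (geq_minr _ _).
have inner e : e \in E0 :|: E1 :|: C -> e \notin C ->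
    e \subset V0 \/ e \subset V1.
  rewrite !inE => + /negPf eC; rewrite eC orbF.
  by case/orP=> [/simple0|/simple1] [_ sub]; [left | right].
have sum_le := sum_crossing_edges_le disjV inner.
(* Stated for every [q] with as many crossings as [p], to serve both [p] and [p * tperm a b]. *)
have notin q : crossing V0 V1 q = crossing V0 V1 p ->
    q \notin Prod (edge_transpositions (E0 :|: E1 :|: C)).
  move=> eq_qp; apply/negP=> /(Prod_crossing_le disjV coverV) le_q.
  have := leq_trans C_small lt_p.
  by rewrite ltnNge -eq_qp (leq_trans le_q sum_le).
have pq : odd_perm p != odd_perm (p * tperm a b)%g.
  by rewrite odd_permM odd_tperm ab addbT; case: odd_perm.
case: (perm_complete_odd_or_even complete pq); apply/negP/notin => //.
exact: crossing_mul_tperm.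
Qed.
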